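(* Let $U_1, U_2, U_3$ be complex vector spaces of dimensions $u_1, u_2, u_3$, with $u_1\ge 2$, such that $\lambda(u_1) u_2 < u_3 < u_1 u_2$, where $\lambda(u_1) = \frac{u_1 + \sqrt{u_1^2 - 4}}{2}$. Then there exist tensors $T, S \in U_1 \otimes U_2 \otimes U_3$ such that $T$ partially degenerates to $S$, but $T$ does not restrict to $S$.
   Context: For tensors $T \in U_1 \otimes U_2 \otimes U_3$ and $S \in V_1\otimes V_2\otimes V_3$ (finite-dimensional complex vector spaces): - $T$ restricts to $S$ if there are linear maps $A_i: U_i\to V_i$ ($i=1,2,3$) with $S=(A_1\otimes A_2\otimes A_3)T$. - $T$ partially degenerates to $S$ if there are a linear map $A_1:U_1\to V_1$ (constant) and linear maps $A_2(\epsilon):U_2\to V_2$, $A_3(\epsilon):U_3\to V_3$ with entries in $\mathbb{C}[\epsilon]$, natural numbers $d,e\ge 0$ and tensors $S_1,\dots,S_e \in V_1\otimes V_2\otimes V_3$ such that $(A_1\otimes A_2(\epsilon)\otimes A_3(\epsilon))T=\epsilon^d S+\epsilon^{d+1}S_1+\dots+\epsilon^{d+e}S_e$. *)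

(* Defs.v *)
From HB Require Import structures.
From mathcomp Require Import all_boot all_order all_algebra.
From mathcomp Require Import reals.
From mathcomp Require Import complex.

Set Implicit Arguments.
Unset Strict Implicit.
Unset Printing Implicit Defensive.

Import Order.TTheory GRing.Theory Num.Theory.
Local Open Scope ring_scope.

(* Elements of K^m (x) K^n (x) K^p, as arrays of coordinates in the standard
   basis e_a (x) e_b (x) e_c; K may be a ring, so that K := {poly C} gives the
   tensors with coefficients in C[eps], eps being 'X. *)
Definition tensor3 (K : Type) (m n p : nat) : Type :=
  {ffun 'I_m * 'I_n * 'I_p -> K}.

Definition map_tensor3 (K L : Type) (f : K -> L) (m n p : nat)
    (T : tensor3 K m n p) : tensor3 L m n p :=
  [ffun x => f (T x)].

(* (A1 (x) A2 (x) A3) T. A linear map K^u -> K^v is a v x u matrix acting on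
   column vectors. *)
Definition tensor3_act (K : comNzRingType) (u1 u2 u3 v1 v2 v3 : nat)
    (A1 : 'M[K]_(v1, u1)) (A2 : 'M[K]_(v2, u2)) (A3 : 'M[K]_(v3, u3))
    (T : tensor3 K u1 u2 u3) : tensor3 K v1 v2 v3 :=
  [ffun x => \sum_(a < u1) \sum_(b < u2) \sum_(c < u3)
     A1 x.1.1 a * A2 x.1.2 b * A3 x.2 c * T (a, b, c)].

Definition restricts (K : comNzRingType) (u1 u2 u3 v1 v2 v3 : nat)
    (T : tensor3 K u1 u2 u3) (S : tensor3 K v1 v2 v3) : Prop :=
  exists (A1 : 'M[K]_(v1, u1)) (A2 : 'M[K]_(v2, u2)) (A3 : 'M[K]_(v3, u3)),
    S = tensor3_act A1 A2 A3 T.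

(* The tensor S_(k+1) of the usual expansion is [E k], for k < e. *)
Definition partially_degenerates (K : comNzRingType)
    (u1 u2 u3 v1 v2 v3 : nat)
    (T : tensor3 K u1 u2 u3) (S : tensor3 K v1 v2 v3) : Prop :=
  exists (A1 : 'M[K]_(v1, u1))
         (A2 : 'M[{poly K}]_(v2, u2)) (A3 : 'M[{poly K}]_(v3, u3))
         (d e : nat) (E : 'I_e -> tensor3 K v1 v2 v3),
    tensor3_act (map_mx polyC A1) A2 A3 (map_tensor3 polyC T) =
    [ffun x => 'X^d * (S x)%:P + \sum_(k < e) 'X^(d + k.+1) * (E k x)%:P].

Definition lambda (R : realType) (u : nat) : R :=
  (u%:R + Num.sqrt (u%:R ^+ 2 - 4)) / 2.

(* Main.v *)
Require Import Defs.
From HB Require Import structures.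
From mathcomp Require Import all_boot all_order all_algebra.
From mathcomp Require Import reals.
From mathcomp Require Import complex.
From mathcomp Require Import zify ring lra.

Set Implicit Arguments.
Unset Strict Implicit.
Unset Printing Implicit Defensive.

Import Order.TTheory GRing.Theory Num.Theory.
Local Open Scope ring_scope.

(** Put m = u1, n = u2, p = u3.  A tensor in K^m (x) K^n (x) K^p is studied
    through the space of m x n matrices obtained by contracting its third leg.
    Since lambda(m) >= m - 1 ([lambda_ge]), the hypotheses give p = m n - q with
    0 < q < n.  Rows and columns are numbered from 0.

    - S is the tensor whose contractions are all the matrices vanishing in the
      first q entries of row 0.
    - T is S with the corner matrix unit E(0,0) added to the slice E(1,n-1), so
      all its contractions satisfy M(0,0) = M(1,n-1).

    T partially degenerates to S: rescale the basis vector of column 0 by eps,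
    and rescale the third leg so that every slice of S gets multiplied by eps in
    total.  The slice E(1,n-1) does not lie in column 0, so its third-leg factor
    is eps, and the added E(0,0) acquires eps * eps.  Hence T is sent to
    eps S + eps^2 (T - S) ([tilted_degenerates_coordinate]).

    T does not restrict to S: a restriction (A1, A2, A3) writes every
    contraction of S as A1 M A2^T with M(0,0) = M(1,n-1).  The contractions of S
    have no common kernel on either side, so A1 and A2 are invertible.  They
    include all matrices with zero row 0, that is (hyperplane of K^m) (x) K^n;
    pulled back by A1 and A2, some hyperplane H of K^m satisfies
    h(0) u(0) = h(1) u(n-1) for all h in H and u in K^n.  As n > 1 this forces
    h(0) = h(1) = 0 on H, which has codimension only 1: a contradiction
    ([tilted_not_restricts_coordinate]).  Dually, the annihilator of the
    contractions of S contains only matrices of rank at most 1, whereas that of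
    T contains E(0,0) - E(1,n-1). *)

(** * Contraction of the third leg and diagonal actions *)

Definition contract3 (K : comNzRingType) (m n p : nat) (T : tensor3 K m n p)
    (psi : 'rV[K]_p) : 'M[K]_(m, n) :=
  \matrix_(a, b) \sum_c psi 0 c * T (a, b, c).

(** The third map only reparametrises the contractions, so that a restriction
    becomes a statement about spaces of matrices, involving A1 and A2 alone. *)
Lemma contract3_act (K : comNzRingType) (u1 u2 u3 v1 v2 v3 : nat)
    (A1 : 'M[K]_(v1, u1)) (A2 : 'M[K]_(v2, u2)) (A3 : 'M[K]_(v3, u3))
    (T : tensor3 K u1 u2 u3) (psi : 'rV[K]_v3) :
  contract3 (tensor3_act A1 A2 A3 T) psi
  = A1 *m contract3 T (psi *m A3) *m A2^T.
Proof.
apply/matrixP=> i j; rewrite !mxE.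
under eq_bigr => c _.
  rewrite ffunE mulr_sumr.
  under eq_bigr => a _.
    rewrite mulr_sumr.
    under eq_bigr => b _ do rewrite mulr_sumr.
    over.
  over.
rewrite exchange_big /=.
under [RHS]eq_bigr => b _ do rewrite !mxE mulr_suml.
rewrite [RHS]exchange_big /=; apply: eq_bigr => a _.
rewrite exchange_big /=; apply: eq_bigr => b _.
rewrite !mxE mulr_sumr mulr_suml exchange_big /=; apply: eq_bigr => c _.
rewrite !mxE mulr_suml mulr_sumr mulr_suml; apply: eq_bigr => c' _.
by ring.
Qed.

Lemma tensor3_act_diag (K : comNzRingType) (m n p : nat)
    (d1 : 'rV[K]_m) (d2 : 'rV[K]_n) (d3 : 'rV[K]_p) (T : tensor3 K m n p) :
  tensor3_act (diag_mx d1) (diag_mx d2) (diag_mx d3) T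
  = [ffun x => d1 0 x.1.1 * d2 0 x.1.2 * d3 0 x.2 * T x].
Proof.
apply/ffunP => -[[a b] c]; rewrite !ffunE /=.
rewrite (bigD1 a) //= [X in _ + X]big1 ?addr0; last first.
  move=> a' na; rewrite big1 // => b' _; rewrite big1 // => c' _.
  by rewrite !mxE eq_sym (negPf na) mulr0n !mul0r.
rewrite (bigD1 b) //= [X in _ + X]big1 ?addr0; last first.
  move=> b' nb; rewrite big1 // => c' _.
  by rewrite !mxE [b == _]eq_sym (negPf nb) mulr0n mulr0 !mul0r.
rewrite (bigD1 c) //= [X in _ + X]big1 ?addr0; last first.
  by move=> c' nc; rewrite !mxE [c == _]eq_sym (negPf nc) mulr0n mulr0 !mul0r.
by rewrite !mxE !eqxx !mulr1n.
Qed.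

(** * The two tensors *)

(** The pair (a, b) is read as the number a n + b < m n; the slice of index c is
    the matrix unit of number q + c, so the q missing units are the first ones,
    which all lie in row 0 when q <= n. *)
Definition coordinate_tensor (K : comNzRingType) (m n p q : nat) :
    tensor3 K m n p :=
  [ffun x : 'I_m * 'I_n * 'I_p => (x.1.1 * n + x.1.2 == q + x.2)%N%:R].

(** The third index is the one of the slice E(1,n-1) of [coordinate_tensor],
    since that matrix unit has number n + (n - 1). *)
Definition corner_tensor (K : comNzRingType) (m n p q : nat) :
    tensor3 K m n p :=
  [ffun x : 'I_m * 'I_n * 'I_p =>
     ([&& val x.1.1 == 0, val x.1.2 == 0 & q + x.2 == n + n.-1]%N)%:R].

Definition tilted_tensor (K : comNzRingType) (m n p q : nat) :
    tensor3 K m n p :=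
  [ffun x : 'I_m * 'I_n * 'I_p =>
     coordinate_tensor K m n p q x + corner_tensor K m n p q x].

(** * The partial degeneration *)

Lemma tilted_degenerates_coordinate (K : comNzRingType) (m n p q : nat) :
  (1 < n)%N ->
  partially_degenerates (tilted_tensor K m n p q) (coordinate_tensor K m n p q).
Proof.
move=> n1.
pose d2 : 'rV[{poly K}]_n := \row_b (if (b == 0 :> nat)%N then 'X else 1).
pose d3 : 'rV[{poly K}]_p := \row_c (if (n %| q + c)%N then 1 else 'X).
exists 1%:M, (diag_mx d2), (diag_mx d3), 1, 1, (fun=> corner_tensor K m n p q).
rewrite map_scalar_mx -diag_const_mx tensor3_act_diag.
apply/ffunP => -[[a b] c]; rewrite !ffunE big_ord1 ?ffunE !mxE /= mul1r.
(* On the support of the coordinate tensor exactly one of the two scalings is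
   nontrivial; on the support of the corner both are. *)
have [e | _] := eqVneq (a * n + b)%N (q + c)%N.
  have -> : (n %| q + c)%N = (b == 0 :> nat)%N.
    by rewrite -e dvdn_addr ?dvdn_mull // /dvdn modn_small.
  have -> : [&& a == 0 :> nat, b == 0 :> nat & q + c == n + n.-1]%N = false.
    apply/negP => /and3P[/eqP a0 /eqP b0 /eqP f].
    by move: e; rewrite a0 b0; lia.
  by rewrite addr0 mulr0 addr0; case: ifP => _; rewrite ?mulr1 ?mul1r.
have [/and3P[_ /eqP b0 /eqP e] | _] := boolP [&& _, _ & _]; last first.
  by rewrite addr0 !mulr0 addr0.
rewrite b0 e eqxx dvdn_addr ?dvdnn // [(n %| _)%N]gtnNdvd; [|lia..].
by rewrite add0r mulr0 add0r exprD expr1.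
Qed.

(** * The obstruction to restriction *)

Lemma contract_tilted (K : comNzRingType) (m n p q : nat)
    (i0 i1 : 'I_m) (j0 jl : 'I_n) (psi : 'rV[K]_p) :
  i0 = 0%N :> nat -> i1 = 1%N :> nat -> j0 = 0%N :> nat -> jl = n.-1 :> nat ->
  (0 < q)%N ->
  let M := contract3 (tilted_tensor K m n p q) psi in M i0 j0 = M i1 jl.
Proof.
move=> ei0 ei1 ej0 ejl q0 /=; rewrite !mxE; apply: eq_bigr => c _.
rewrite !ffunE /= ei0 ei1 ej0 ejl !eqxx /= mul1n addr0 mul0n add0n.
have -> : (0 == q + c)%N = false by lia.
by rewrite add0r eq_sym.
Qed.

Lemma contract_coordinate_onto (K : comNzRingType) (m n p q : nat)
    (X : 'M[K]_(m, n)) :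
  (p + q = m * n)%N ->
  (forall (a : 'I_m) (b : 'I_n), (a * n + b < q)%N -> X a b = 0) ->
  exists psi, contract3 (coordinate_tensor K m n p q) psi = X.
Proof.
move=> epq X0.
have [n0 | n0] := posnP n.
  by exists 0; apply/matrixP => a b; have := ltn_ord b; lia.
have ltm (c : 'I_p) : ((q + c) %/ n < m)%N.
  by rewrite ltn_divLR // -epq addnC ltn_add2r.
have ltn_r (c : 'I_p) : ((q + c) %% n < n)%N by rewrite ltn_mod.
exists (\row_c X (Ordinal (ltm c)) (Ordinal (ltn_r c))).
apply/matrixP => a b; rewrite mxE.
have [lt | le] := ltnP (a * n + b) q.
  rewrite X0 // big1 // => c _; rewrite ffunE /=.
  have -> : (a * n + b == q + c)%N = false by lia.
  by rewrite mulr0.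
have ltc : (a * n + b - q < p)%N.
  have : ((a.+1) * n <= m * n)%N by rewrite leq_mul2r ltn_ord orbT.
  by have := ltn_ord b; rewrite mulSn; lia.
rewrite (bigD1 (Ordinal ltc)) //= big1 ?addr0 => [|c nc]; last first.
  rewrite ffunE /=.
  have -> : (a * n + b == q + c)%N = false.
    by apply: contraNF nc => /eqP e; apply/eqP/val_inj => /=; lia.
  by rewrite mulr0.
rewrite ffunE mxE.
have -> : (a * n + b == q + Ordinal ltc)%N by rewrite /= subnKC.
rewrite mulr1; congr (X _ _); apply: val_inj => /=.
  by rewrite subnKC // divnMDl // divn_small // addn0.
by rewrite subnKC // modnMDl modn_small.
Qed.

(** By [contract3_act], every contraction of the coordinate tensor has the form
    A1 M A2^T with M(0,0) = M(1,n-1).  Once A1 and A2 are known to be invertible,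
    this condition pulls back to every M such that A1 M has zero row 0. *)
Lemma tilted_not_restricts_coordinate (K : fieldType) (m n p q : nat) :
  (1 < m)%N -> (0 < q)%N -> (q < n)%N -> (p + q = m * n)%N ->
  ~ restricts (tilted_tensor K m n p q) (coordinate_tensor K m n p q).
Proof.
move=> m1 q0 qn epq [A1 [A2 [A3 eS]]].
have m0 : (0 < m)%N by lia.
have n0 : (0 < n)%N by lia.
have nl : (n.-1 < n)%N by lia.
pose i0 := Ordinal m0; pose i1 := Ordinal m1.
pose j0 := Ordinal n0; pose jl := Ordinal nl.
have j0l : (j0 == jl) = false by apply/eqP => /(congr1 val) /=; lia.
have sub (X : 'M[K]_(m, n)) :
    (forall (a : 'I_m) (b : 'I_n), (a * n + b < q)%N -> X a b = 0) ->
    exists2 M : 'M_(m, n), X = A1 *m M *m A2^T & M i0 j0 = M i1 jl.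
  move=> X0; have [psi <-] := contract_coordinate_onto epq X0.
  exists (contract3 (tilted_tensor K m n p q) (psi *m A3)).
    by rewrite -contract3_act -eS.
  exact: contract_tilted.
have subE (a : 'I_m) (b : 'I_n) : (q <= a * n + b)%N ->
    exists M : 'M_(m, n), delta_mx a b = A1 *m M *m A2^T.
  move=> le; have [|M eM _] := sub (delta_mx a b); last by exists M.
  move=> a' b' lt; rewrite mxE; case: eqP => //= ea; case: eqP => //= eb.
  by move: le lt; rewrite ea eb; lia.
(* A left kernel vector of A1 would kill the units E(a,n-1), which are all
   contractions of the coordinate tensor because q < n. *)
have A1u : A1 \in unitmx.
  rewrite -row_free_unit; apply: inj_row_free => v vA.
  apply/rowP => a; have [|M eM] := subE a jl; first by rewrite /=; nia.
  move/(congr1 (fun Y => (v *m Y) 0 jl)): eM.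
  rewrite !mulmxA vA !mul0mx !mxE (bigD1 a) //= big1 ?addr0 => [|k nk].
    by rewrite mxE !eqxx mulr1.
  by rewrite mxE (negPf nk) mulr0.
(* Likewise for A2, with the units E(1,b). *)
have A2u : A2^T \in unitmx.
  rewrite unitmx_tr -row_free_unit; apply: inj_row_free => v vA.
  apply/rowP => b; have [|M eM] := subE i1 b; first by rewrite /=; lia.
  move/(congr1 (fun Y => (Y *m v^T) i1 0)): eM.
  rewrite -!mulmxA -trmx_mul vA trmx0 !mulmx0 !mxE (bigD1 b) //=.
  rewrite big1 ?addr0 => [|k nk]; first by rewrite !mxE !eqxx mul1r.
  by rewrite mxE (negPf nk) andbF mul0r.
have hyper (Z : 'M_(m, n)) : row i0 (A1 *m Z) = 0 -> Z i0 j0 = Z i1 jl.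
  move=> Z0; have [a b lt | M eM hM] := sub (A1 *m Z *m A2^T).
    have -> : a = i0 by apply: val_inj => /=; nia.
    transitivity (row i0 (A1 *m Z *m A2^T) 0 b); first by rewrite [RHS]mxE.
    by rewrite row_mul Z0 mul0mx mxE.
  have /(can_inj (mulKmx A1u)) -> // : A1 *m Z = A1 *m M.
  exact: (can_inj (mulmxK A2u)).
(* Apply [hyper] to the matrices with h in the first or last column and zeros
   elsewhere; these two columns are distinct as n > 1. *)
have ker (h : 'cV_m) : (A1 *m h) i0 0 = 0 -> h i0 0 = 0 /\ h i1 0 = 0.
  move=> h0.
  have h' j : h i0 0 *+ (j0 == j) = h i1 0 *+ (jl == j).
    have := hyper (h *m delta_mx 0 j).
    rewrite mulmxA row_mul.
    have -> : row i0 (A1 *m h) = 0.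
      by apply/rowP => k; rewrite ord1 [LHS]mxE h0 mxE.
    rewrite mul0mx => /(_ erefl); rewrite !mxE !big_ord1 !mxE /=.
    by rewrite !mulr_natr ![_ == j]eq_sym.
  have := h' j0; have := h' jl; rewrite !eqxx [jl == j0]eq_sym j0l.
  by rewrite !mulr0n !mulr1n => <- ->.
have A1E (h : 'I_m) : (A1 *m delta_mx h (0 : 'I_1)) i0 0 = A1 i0 h.
  by rewrite -colE mxE.
(* In the plane spanned by the first two basis vectors, row 0 of A1 is one linear
   form, so it has a nonzero kernel vector, against [ker]: the combination below
   or, if its coefficients vanish, the first basis vector itself. *)
have [|] := ker (A1 i0 i1 *: delta_mx i0 0 - A1 i0 i0 *: delta_mx i1 0).
  rewrite mulmxBr -!scalemxAr !mxE.
  have /= := A1E i0; rewrite mxE => ->; have /= := A1E i1; rewrite mxE => ->.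
  by rewrite mulrC subrr.
rewrite !mxE /= !(mulr0, mulr1) subr0 sub0r => _ /eqP.
rewrite oppr_eq0 => /eqP A00.
have [|] := ker (delta_mx i0 0); first by rewrite A1E.
by rewrite !mxE /= => /eqP; rewrite oner_eq0.
Qed.

(** * The numerical hypothesis *)

(** sqrt(u^2 - 4) >= u - 2, as u^2 - 4 - (u - 2)^2 = 4 (u - 2) >= 0. *)
Lemma lambda_ge (R : realType) (u : nat) :
  (2 <= u)%N -> (u%:R - 1 : R) <= lambda R u.
Proof.
move=> u2; have {}u2 : (2 : R) <= u%:R by rewrite ler_nat.
suff : (u%:R - 2 : R) <= Num.sqrt (u%:R ^+ 2 - 4) by rewrite /lambda; lra.
rewrite -[leLHS]ger0_norm ?subr_ge0 // -sqrtr_sqr ler_wsqrtr // !expr2.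
by nra.
Qed.

Theorem theorem3p12 (R : realType) (u1 u2 u3 : nat)
  (hu1 : (2 <= u1)%N)
  (hlow : lambda R u1 * u2%:R < u3%:R)
  (hup : (u3 < u1 * u2)%N) :
  exists T S : tensor3 R[i] u1 u2 u3,
    partially_degenerates T S /\ ~ restricts T S.
Proof.
pose q := (u1 * u2 - u3)%N.
have lt_u3 : (u1.-1 * u2 < u3)%N.
  rewrite -(ltr_nat R); apply: le_lt_trans hlow.
  rewrite natrM ler_wpM2r // -subn1 natrB ?lambda_ge //; lia.
have qn : (q < u2)%N.
  have : (u1 * u2 = u2 + u1.-1 * u2)%N by rewrite -mulSn prednK // ltnW.
  by rewrite /q; lia.
have q0 : (0 < q)%N by rewrite subn_gt0.
exists (tilted_tensor _ _ _ _ q), (coordinate_tensor _ _ _ _ q); split.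
  by apply: tilted_degenerates_coordinate; lia.
by apply: tilted_not_restricts_coordinate => //; rewrite /q subnKC // ltnW.
Qed.
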